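(* Consider a countable-state MDP $(\mathbb{X},\mathbb{A},A(\cdot),c,q)$ satisfying the Compactness Conditions, and suppose there are a weight function $V:\mathbb{X}\to[1,\infty)$ and constants $K\ge 1$, $\bar c<\infty$ such that (a) $\|\sum_{n=0}^\infty Q_\phi^n\|_V\le K$ for all $\phi\in\mathbb{F}$; (b) $\sup_{a\in A(x)}|c(x,a)|\le \bar c\,V(x)$ for all $x\in\mathbb{X}$; (c) for every $x\in\mathbb{X}$ the mapping $a\mapsto\sum_{y\in\mathbb{X}}q(y|x,a)V(y)$ is finite and continuous on $A(x)$. Let $\mu$ be a function with $V\le\mu\le KV$ and $\mu(x)\ge V(x)+\sum_{y\in\mathbb{X}}q(y|x,a)\mu(y)$ for all $x\in\mathbb{X}$, $a\in A(x)$, let $\tilde\beta\in[\frac{K-1}{K},1)$, and let $\tilde v_{\tilde\beta}$ be the value function of the discounted MDP defined by the HV transformation. Let $v$ be the total-cost value function of the original MDP. Then: (i) $v(x)=\mu(x)\tilde v_{\tilde\beta}(x)$ for $x\in\mathbb{X}$, and $v$ is the unique function satisfying the optimality equation $$v(x)=\min_{a\in A(x)}\Big[c(x,a)+\sum_{y\in\mathbb{X}}q(y|x,a)v(y)\Big],\quad x\in\mathbb{X},$$ and such that $\sup_{x\in\mathbb{X}}V(x)^{-1}|v(x)|<\infty$; (ii) there is a stationary total-cost optimal policy; (iii) a policy $\phi\in\mathbb{F}$ is total-cost optimal if and only if $\phi(x)\in A^*(x)$ for all $x\in\mathbb{X}$, where $A^*(x):=\{a\in A(x): v(x)=c(x,a)+\sum_{y\in\mathbb{X}}q(y|x,a)v(y)\}$;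 moreover $$A^*(x)=\Big\{a\in A(x):\ \tilde v_{\tilde\beta}(x)=\tilde c(x,a)+\tilde\beta\sum_{y\in\tilde{\mathbb{X}}}\tilde p(y|x,a)\tilde v_{\tilde\beta}(y)\Big\},\quad x\in\mathbb{X},$$ i.e., the sets of optimal actions for the original transient MDP and for the transformed discounted MDP coincide.
   Context: Countable-state MDP: $\mathbb{X}$ is a countable set (states); $\mathbb{A}$ is a Borel subset of a complete separable metric space; for each $x\in\mathbb{X}$, $A(x)$ is a nonempty Borel subset of $\mathbb{A}$ (available actions); the real-valued one-step cost $c(x,a)$ is Borel measurable in $a\in A(x)$ for each $x$; the transition rates $q(y|x,a)\ge 0$ are measurable in $a\in A(x)$ for all $x,y$ and satisfy $\sup_{x\in\mathbb{X},a\in A(x)}\sum_{y\in\mathbb{X}}q(y|x,a)<\infty$ (the sums need not equal 1). Write $q(\mathbb{X}|x,a):=\sum_{y\in\mathbb{X}}q(y|x,a)$. A stationary policy is a map $\phi:\mathbb{X}\to\mathbb{A}$ with $\phi(x)\in A(x)$ for all $x$; $\mathbb{F}$ is the set of all of them. $Q_\phi$ is the matrix with entries $q(y|x,\phi(x))$, $c_\phi(x):=c(x,\phi(x))$, and a matrix $B$ acts on functions by $Bu(x)=\sum_y B(x,y)u(y)$. For a weight function $W:\mathbb{X}\to[1,\infty)$ and a matrix $B$, $\|B\|_W:=\sup_{x}W(x)^{-1}\sum_{y}|B(x,y)|W(y)$. Total cost: $v^\phi(x):=\sum_{n=0}^\infty Q_\phi^nc_\phi(x)$, $v(x):=\inf_{\phi\in\mathbb{F}}v^\phi(x)$;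 $\phi_*\in\mathbb{F}$ is total-cost optimal if $v^{\phi_*}(x)=v(x)$ for all $x$. Compactness Conditions: (i) $A(x)$ is compact for each $x$; (ii) $c(x,a)$ is lower semicontinuous in $a\in A(x)$ for each $x$; (iii) $q(y|x,a)$ is continuous in $a\in A(x)$ for all $x,y$; (iv) $q(\mathbb{X}|x,a)$ is continuous in $a\in A(x)$ for each $x$. HV transformation (given $V,K,\mu,\tilde\beta$ as in the claim; under (a) such a $\mu$ exists): state space $\tilde{\mathbb{X}}:=\mathbb{X}\cup\{\tilde x\}$ with $\tilde x\notin\mathbb{X}$, action space $\mathbb{A}\cup\{\tilde a\}$, action sets $\tilde A(x):=A(x)$ for $x\in\mathbb{X}$ and $\tilde A(\tilde x):=\{\tilde a\}$; costs $\tilde c(x,a):=\mu(x)^{-1}c(x,a)$ for $x\in\mathbb{X}$, $a\in A(x)$, and $\tilde c(\tilde x,\tilde a):=0$; transition probabilities, for $x\in\mathbb{X}$, $a\in A(x)$: $\tilde p(y|x,a):=\frac{1}{\tilde\beta\mu(x)}q(y|x,a)\mu(y)$ for $y\in\mathbb{X}$, $\tilde p(\tilde x|x,a):=1-\frac{1}{\tilde\beta\mu(x)}\sum_{y\in\mathbb{X}}q(y|x,a)\mu(y)$, and $\tilde p(\tilde x|\tilde x,\tilde a):=1$. (If $\tilde\beta=0$, which forces $K=1$ and $q\equiv0$, quotients $0/0$ are read as $0$.) Policies $\phi\in\mathbb{F}$ are extended by $\phi(\tilde x):=\tilde a$. With $\tilde P_\phi(x,y):=\tilde p(y|x,\phi(x))$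 and $\tilde c_\phi(x):=\tilde c(x,\phi(x))$, the discounted cost is $\tilde v^\phi_{\tilde\beta}(x):=\sum_{n=0}^\infty\tilde\beta^n\tilde P_\phi^n\tilde c_\phi(x)$ (with $0^0=1$) and $\tilde v_{\tilde\beta}(x):=\inf_{\phi\in\mathbb{F}}\tilde v^\phi_{\tilde\beta}(x)$, $x\in\tilde{\mathbb{X}}$. *)

(* Defs.v *)
From HB Require Import structures.
From mathcomp Require Import all_boot all_order all_algebra.
From mathcomp Require Import all_classical all_reals all_analysis.

Set Implicit Arguments.
Unset Strict Implicit.
Unset Printing Implicit Defensive.
Import Order.TTheory GRing.Theory Num.Theory.
Import numFieldNormedType.Exports.

Local Open Scope classical_set_scope.
Local Open Scope ring_scope.
Local Open Scope ereal_scope.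

#[short(type="completeMetricType")]
HB.structure Definition CompleteMetric (R : numDomainType) :=
  {T of CompletePseudoMetric R T & PseudoMetric_isMetric R T}.

Definition separable (T : topologicalType) : Prop :=
  exists D : set T, countable D /\ dense D.

Definition borel (T : ptopologicalType) (B : set T) : Prop :=
  (@open T).-sigma.-measurable B.

Definition borel_fun (R : realType) (T : ptopologicalType) (D : set T)
    (f : T -> R) : Prop :=
  measurable_fun (D : set (g_sigma_algebraType (@open T))) f.

Definition minimum_of (R : realType) (S : set (\bar R)) (m : \bar R) : Prop :=
  S m /\ lbound S m.

Section Matrices.
Context {R : realType} {S : countType}.
Implicit Types (B C : S -> S -> \bar R) (u : S -> \bar R) (W : S -> R).

(* [\esum] is a supremum of finite partial sums, hence meaningful only for
   nonnegative families; this is its extension to signed ones.  It is the usual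
   sum when the family is absolutely summable. *)
Definition csum u : \bar R :=
  \esum_(y in [set: S]) u^\+ y - \esum_(y in [set: S]) u^\- y.

Definition mxact B u : S -> \bar R := fun x => csum (fun y => B x y * u y).

Definition mxid : S -> S -> \bar R := fun x y => ((x == y)%:R)%:E.

Definition mxmul B C : S -> S -> \bar R :=
  fun x y => csum (fun z => B x z * C z y).

Definition mxpow B (n : nat) : S -> S -> \bar R := iter n (mxmul B) mxid.

Definition mxpow_series B : S -> S -> \bar R :=
  fun x y => \sum_(0 <= n <oo) mxpow B n x y.

Definition weight W : Prop := forall x, (1 <= W x)%R.

Definition wnorm W u : \bar R :=
  ereal_sup (range (fun x => ((W x)^-1)%:E * `|u x|)).

Definition wmxnorm W B : \bar R :=
  ereal_sup (range (fun x =>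
    ((W x)^-1)%:E * \esum_(y in [set: S]) (`|B x y| * (W y)%:E))).

End Matrices.

Section Costs.
Context {R : realType} {S : countType} {Act : Type}.
Implicit Types (p : S -> Act -> S -> \bar R) (c : S -> Act -> R).
Implicit Types (phi : S -> Act).

(* [p x a y] stands for p(y|x,a). *)
Definition pol_mx p phi : S -> S -> \bar R := fun x y => p x (phi x) y.

Definition pol_cost c phi : S -> \bar R := fun x => (c x (phi x))%:E.

Definition undiscounted_cost p c phi : S -> \bar R := fun x =>
  \sum_(0 <= n <oo) mxact (mxpow (pol_mx p phi) n) (pol_cost c phi) x.

Definition discounted_cost (beta : R) p c phi : S -> \bar R := fun x =>
  \sum_(0 <= n <oo)
    (beta ^+ n)%:E * mxact (mxpow (pol_mx p phi) n) (pol_cost c phi) x.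

End Costs.

(* [rate x a y] stands for q(y|x,a).  The values of [cost] and [rate] at actions
   outside [avail x] are irrelevant. *)
Record mdp (R : realType) (X : countType) (A : completeMetricType R) := MDP {
  actions : set A;
  avail : X -> set A;
  cost : X -> A -> R;
  rate : X -> A -> X -> R;
  _ : borel actions;
  _ : forall x, avail x !=set0;
  _ : forall x, avail x `<=` actions;
  _ : forall x, borel (avail x);
  _ : forall x, borel_fun (avail x) (cost x);
  _ : forall x a y, avail x a -> (0 <= rate x a y)%R;
  _ : forall x y, borel_fun (avail x) (fun a => rate x a y);
  _ : ereal_sup [set s | exists x, exists2 a, avail x a &
        s = \esum_(y in [set: X]) (rate x a y)%:E] < +oo
}.

Section Model.
Context {R : realType} {X : countType} {A : completeMetricType R}.
Variable M : mdp X A.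
Implicit Types (phi : X -> A) (u : X -> \bar R).

Definition erate (x : X) (a : A) (y : X) : \bar R := (rate M x a y)%:E.

Definition total_rate (x : X) (a : A) : \bar R :=
  \esum_(y in [set: X]) erate x a y.

Definition policies : set (X -> A) :=
  [set phi | forall x, avail M x (phi x)].

Definition Qmx phi : X -> X -> \bar R := pol_mx erate phi.

Definition total_cost phi : X -> \bar R := undiscounted_cost erate (cost M) phi.

Definition total_value (x : X) : \bar R :=
  ereal_inf [set total_cost phi x | phi in policies].

Definition total_optimal phi : Prop :=
  policies phi /\ forall x, total_cost phi x = total_value x.

Definition compactness_conditions : Prop :=
  [/\ forall x, compact (avail M x),
      forall x, lower_semicontinuous
        (fun a : subspace (avail M x) => (cost M x a)%:E),
      forall x y, {within avail M x, continuous (fun a => rate M x a y)} &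
      forall x, {within avail M x, continuous (total_rate x)}].

Definition one_step (u : X -> \bar R) (x : X) (a : A) : \bar R :=
  (cost M x a)%:E + csum (fun y => erate x a y * u y).

Definition optimality_equation u : Prop :=
  forall x, minimum_of [set one_step u x a | a in avail M x] (u x).

Definition conserving (x : X) : set A :=
  [set a | avail M x a /\ total_value x = one_step total_value x a].

(* The additional state and the additional action of the transformed model are
   both [None].  As 0^-1 = 0, quotients 0 / 0 are 0. *)
Section HVTransformation.
Variables (mu : X -> R) (beta : R).

Definition hv_cost (x : option X) (a : option A) : R :=
  match x, a with
  | Some x, Some a => ((mu x)^-1 * cost M x a)%R
  | _, _ => 0%R
  end.

Definition hv_prob (x : option X) (a : option A) (y : option X) : \bar R :=
  match x, a, y with
  | Some x, Some a, Some y => ((beta * mu x)^-1 * rate M x a y * mu y)%:E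
  | Some x, Some a, None => 1 - ((beta * mu x)^-1)%:E *
      \esum_(z in [set: X]) (rate M x a z * mu z)%:E
  | None, None, None => 1
  | _, _, _ => 0
  end.

Definition hv_policy phi (x : option X) : option A := omap phi x.

Definition hv_discounted_cost phi : option X -> \bar R :=
  discounted_cost beta hv_prob hv_cost (hv_policy phi).

Definition hv_value (x : option X) : \bar R :=
  ereal_inf [set hv_discounted_cost phi x | phi in policies].

Definition hv_conserving (x : X) : set A :=
  [set a | avail M x a /\
    hv_value (Some x) = (hv_cost (Some x) (Some a))%:E +
      beta%:E * csum (fun y => hv_prob (Some x) (Some a) y * hv_value y)].

End HVTransformation.

End Model.

(* Main.v *)
Require Import Defs.
From HB Require Import structures.
From mathcomp Require Import all_boot all_order all_algebra.
From mathcomp Require Import all_classical all_reals all_analysis.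
From mathcomp Require Import ring lra.

Set Implicit Arguments.
Unset Strict Implicit.
Unset Printing Implicit Defensive.
Import Order.TTheory GRing.Theory Num.Theory.
Import numFieldNormedType.Exports.

Local Open Scope classical_set_scope.
Local Open Scope ring_scope.
Local Open Scope ereal_scope.

(* The drift inequality and [V <= mu <= K V] give, uniformly in the policy,
   [Q_phi mu <= rho mu] with [rho = (K - 1) / K < 1].  Hence
   [T_phi u = c_phi + Q_phi u] is a monotone contraction in the weighted norm of
   [mu], [v^phi] is its only bounded fixed point, and bounded functions with
   [u <= T_phi u] or [T_phi u <= u] lie below or above [v^phi].
   Condition (c) and the compactness conditions make [c + sum_y q(y|x,a) u(y)]
   lower semicontinuous in [a] for bounded [u], so it is minimised by some policy.
   If [phi] is such a policy for [u = v = inf_phi v^phi], then [T_phi v <= v],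
   whence [v^phi <= v]: [phi] is optimal and [v] solves the optimality equation.
   The transformed model is conjugate to the original one: on [X],
   [beta P~_phi = diag(mu)^-1 Q_phi diag(mu)], and the added state is absorbing
   and free of cost, so its discounted costs are [v^phi / mu]. *)

(** * Signed sums over a countable set *)

Section SignedSums.
Context {R : realType}.

Lemma esumZl (S : choiceType) (r : R) (a : S -> \bar R) :
  (0 <= r)%R -> (forall y, 0 <= a y) ->
  \esum_(y in [set: S]) (r%:E * a y) = r%:E * \esum_(y in [set: S]) a y.
Proof.
move=> r0 a0; rewrite /esum -ereal_supZl//; last first.
  by apply/set0P; exists 0; exists set0; [exact: fsets_set0|rewrite fsbig_set0].
congr ereal_sup; apply/seteqP; split=> [_ [F FS <-]|_ [_ [F FS <-] <-]].
  by exists (\sum_(y \in F) a y); [exists F|rewrite ge0_mule_fsumr].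
by exists F => //; rewrite ge0_mule_fsumr.
Qed.

(** Tonelli: both iterated sums are sums over pairs, matched by swapping the coordinates. *)
Lemma esum_exchange (S T : choiceType) (a : S -> T -> \bar R) :
  (forall x y, 0 <= a x y) ->
  \esum_(x in [set: S]) \esum_(y in [set: T]) a x y =
  \esum_(y in [set: T]) \esum_(x in [set: S]) a x y.
Proof.
move=> a0; rewrite !esum_esum//.
apply: (reindex_esum _ _ (fun k : T * S => (k.2, k.1))).
split=> [[y x] //|[y x] [y' x'] _ _ [-> ->] //|[x y] _].
by exists (y, x).
Qed.

Context {S : countType}.
Implicit Types (f g : S -> \bar R).

Lemma eq_csum f g : f =1 g -> csum f = csum g.
Proof. by move=> /funext ->. Qed.

Lemma csum_ge0E f : (forall y, 0 <= f y) -> csum f = \esum_(y in [set: S]) f y.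
Proof.
move=> f0; rewrite /csum (@esum1 _ _ _ f^\-) ?sube0.
  by apply: eq_esum => y _; rewrite funeposE max_l.
by move=> y _; rewrite funenegE max_r // oppe_le0.
Qed.

Lemma csum_ge0 f : (forall y, 0 <= f y) -> 0 <= csum f.
Proof. by move=> f0; rewrite csum_ge0E//; apply: esum_ge0. Qed.

Lemma le_csum f g : (forall y, f y <= g y) -> csum f <= csum g.
Proof.
move=> fg; apply: leeB; apply: le_esum => y _.
  by rewrite !funeposE le_max2.
by rewrite !funenegE le_max2 ?leeN2.
Qed.

Lemma csum_fin_num f : summable setT f -> csum f \is a fin_num.
Proof.
move=> sf; rewrite fin_numB; apply/andP; split.
  move: (summable_funepos sf); rewrite summableE; congr (_ \is a fin_num).
  by apply: eq_esum => y _; rewrite gee0_abs.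
move: (summable_funeneg sf); rewrite summableE; congr (_ \is a fin_num).
by apply: eq_esum => y _; rewrite gee0_abs.
Qed.

Lemma csumB f g : summable setT f -> summable setT g ->
  csum (fun y => f y - g y) = csum f - csum g.
Proof.
move=> sf sg.
(* These two nonnegative families need not be the positive and negative parts of [f - g]; [esumB]
   makes the value independent of the decomposition. *)
have -> : (fun y => f y - g y) = (f^\+ \+ g^\-) \- (f^\- \+ g^\+).
  by rewrite -[LHS]/(f \+ (\- g)) funeD_posD funeposN funenegN.
rewrite /csum esumB; last 2 first.
- by move=> y _; rewrite adde_ge0.
- by move=> y _; rewrite adde_ge0.
- rewrite !esumD//.
  have := csum_fin_num sf; have := csum_fin_num sg; rewrite !fin_numB.
  case/andP=> /fineK <- /fineK <- /andP[/fineK <- /fineK <-].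
  by rewrite -!(EFinN, EFinD); congr EFin; ring.
- by apply: summableD; [exact: summable_funepos|exact: summable_funeneg].
- by apply: summableD; [exact: summable_funeneg|exact: summable_funepos].
Qed.

(** For [r > 0] the sides agree even when both parts are infinite, since [+oo - +oo] is [-oo] and
    stays so after scaling. *)
Lemma csumZl (r : R) f : (0 <= r)%R -> csum (fun y => r%:E * f y) = r%:E * csum f.
Proof.
move=> r0; rewrite /csum ge0_funeposM// ge0_funenegM// !esumZl//.
have : 0 <= \esum_(y in [set: S]) f^\+ y by apply: esum_ge0.
have : 0 <= \esum_(y in [set: S]) f^\- y by apply: esum_ge0.
move: r0; rewrite le_eqVlt => /predU1P[<-|r0]; first by rewrite !mul0e sube0.
case: (esum _ f^\-) => [b||]//; case: (esum _ f^\+) => [a||]// _ _.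
- by rewrite -!(EFinN, EFinD, EFinM) mulrBr.
- by rewrite gt0_muley.
- by rewrite gt0_muley// addeNy gt0_muleNy.
- by rewrite gt0_muley// gt0_muleNy.
Qed.

(** Used to drop the added state from sums over the transformed state space. *)
Lemma csum_option (f : option S -> \bar R) : f None = 0 ->
  csum f = csum (f \o Some).
Proof.
move=> f0; rewrite /csum.
have E (g : option S -> \bar R) : g None = 0 ->
    \esum_(y in setT) g y = \esum_(y in setT) g (Some y).
  move=> g0; rewrite -(@esum_image _ _ _ setT Some); last by move=> ? ? _ _ [].
  rewrite [RHS]esum_mkcond; apply: eq_esum => -[y|] _.
    by rewrite mem_set//; exists y.
  by case: ifP.
have fp0 : f^\+ None = 0 by rewrite funeposE f0 maxxx.
have fn0 : f^\- None = 0 by rewrite funenegE f0 oppe0 maxxx.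
by rewrite (E _ fp0) (E _ fn0) (funepos_comp f Some) (funeneg_comp f Some).
Qed.

(** * Pairing a nonnegative measure with functions bounded by a weight *)

Section Pairing.
Variable mu : S -> R.

Definition mu_bounded (u : S -> R) : Prop :=
  exists C : R, (0 <= C)%R /\ forall y, (`|u y| <= C * mu y)%R.

(** Real-valued, so that ordinary algebra applies; by [pairingE], [fine] loses nothing on
    [mu_bounded] functions. *)
Definition pairing (w u : S -> R) : R := fine (csum (fun y => (w y)%:E * (u y)%:E)).

Lemma mu_boundedB u u' : mu_bounded u -> mu_bounded u' ->
  mu_bounded (fun y => u y - u' y)%R.
Proof.
move=> [C [C0 uC]] [C' [C'0 uC']]; exists (C + C')%R; split; first exact: addr_ge0.
by move=> y; rewrite mulrDl (le_trans (ler_normB _ _))// lerD.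
Qed.

Context {w : S -> R} {r : R}.
Hypothesis w_ge0 : forall y, (0 <= w y)%R.
Hypothesis w_le : \esum_(y in [set: S]) ((w y)%:E * (mu y)%:E) <= r%:E.

Lemma summable_pairing u : mu_bounded u ->
  summable setT (fun y => (w y)%:E * (u y)%:E).
Proof.
move=> [C [C0 uC]].
have mu0 y : (0 <= C * mu y)%R by exact: le_trans (uC y).
apply: (@le_lt_trans _ _ (\esum_(y in setT) (C%:E * ((w y)%:E * `|mu y|%:E)))).
  apply: le_esum => y _; rewrite -!EFinM/= lee_fin normrM (ger0_norm (w_ge0 y)).
  rewrite mulrCA ler_wpM2l// (le_trans (uC y))// ler_wpM2l//; exact: ler_norm.
(* The sign of [mu] is read off from [|u| <= C mu], which is possible only for [C > 0]; for [C = 0]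
   the dominating family is zero. *)
move: C0; rewrite le_eqVlt => /predU1P[C0|C0].
  by rewrite -C0 esum1 ?ltry// => y _; rewrite mul0e.
have mup y : `|mu y|%R = mu y.
  by rewrite ger0_norm//; have := mu0 y; rewrite pmulr_rge0.
rewrite esumZl ?ltW//; last by move=> y; rewrite -EFinM lee_fin mulr_ge0.
rewrite lte_mul_pinfty// ?lee_fin ?ltW// (le_lt_trans _ (ltry r))//.
by under eq_esum do rewrite mup.
Qed.

Lemma pairingE u : mu_bounded u ->
  csum (fun y => (w y)%:E * (u y)%:E) = (pairing w u)%:E.
Proof.
by move=> bu; rewrite /pairing fineK// csum_fin_num//; exact: summable_pairing.
Qed.

Lemma pairingB u u' : mu_bounded u -> mu_bounded u' ->
  pairing w (fun y => u y - u' y)%R = (pairing w u - pairing w u')%R.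
Proof.
move=> bu bu'; apply: EFin_inj; rewrite EFinB -!pairingE//; last exact: mu_boundedB.
rewrite -csumB; [|exact: summable_pairing..].
by apply: eq_csum => y; rewrite -!EFinM -EFinB mulrBr.
Qed.

Lemma pairing_le u (D : R) : mu_bounded u -> (0 <= D)%R ->
  (forall y, u y <= D * mu y)%R -> (forall y, 0 <= mu y)%R -> (pairing w u <= D * r)%R.
Proof.
move=> bu D0 uD mu0; rewrite -lee_fin -pairingE//.
apply: (@le_trans _ _ (csum (fun y => D%:E * ((w y)%:E * (mu y)%:E)))).
  by apply: le_csum => y; rewrite -!EFinM lee_fin mulrCA ler_wpM2l.
rewrite csumZl// csum_ge0E; last by move=> y; rewrite -EFinM lee_fin mulr_ge0.
by rewrite EFinM lee_wpmul2l ?lee_fin.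
Qed.

End Pairing.
End SignedSums.

(** * Contracting nonnegative kernels *)

Section Kernel.
Context {R : realType} {S : countType}.
Implicit Types (u : S -> R).

Lemma mxmul_ge0 (B D : S -> S -> \bar R) x y :
  (forall x y, 0 <= B x y) -> (forall x y, 0 <= D x y) -> 0 <= mxmul B D x y.
Proof. by move=> B0 D0; apply: csum_ge0 => z; rewrite mule_ge0. Qed.

Lemma mxpow_ge0 (B : S -> S -> \bar R) n x y :
  (forall x y, 0 <= B x y) -> 0 <= mxpow B n x y.
Proof.
move=> B0; elim: n x y => [|n IH] x y; first by rewrite lee_fin ler0n.
exact: mxmul_ge0.
Qed.

Lemma mxact_id (u : S -> \bar R) x : mxact mxid u x = u x.
Proof.
rewrite /mxact /csum /mxid.
have E (g : S -> \bar R) : (forall y, y != x -> g y = 0) -> 0 <= g x ->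
    \esum_(y in setT) g y = g x.
  move=> g0 gx; rewrite -(@esum_set1 _ _ x g gx) [RHS]esum_mkcond.
  apply: eq_esum => y _; case: (eqVneq y x) => [->|yx]; first by rewrite mem_set.
  by rewrite memNset ?g0//=; apply/eqP.
rewrite !E//.
- set f := fun y => _; have /(congr1 (@^~ x)) /= <- := funeposneg f.
  by rewrite /f eqxx mul1e.
- by move=> y; rewrite eq_sym => /negPf yx; rewrite funenegE yx mul0e oppe0 maxxx.
- by move=> y; rewrite eq_sym => /negPf yx; rewrite funeposE yx mul0e maxxx.
Qed.

(** Tonelli, hence the nonnegative [u]; signed functions are reached by a difference in
    [mxact_mxpow]. *)
Lemma mxact_mxmul (B : S -> S -> R) (D : S -> S -> \bar R) u x :
  (forall x y, (0 <= B x y)%R) -> (forall x y, 0 <= D x y) ->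
  (forall y, (0 <= u y)%R) ->
  mxact (mxmul (fun x y => (B x y)%:E) D) (EFin \o u) x =
  mxact (fun x y => (B x y)%:E) (mxact D (EFin \o u)) x.
Proof.
move=> B0 D0 u0; rewrite /mxact csum_ge0E; last first.
  by move=> y; rewrite mule_ge0 ?lee_fin// mxmul_ge0.
rewrite csum_ge0E; last first.
  move=> y; rewrite mule_ge0 ?lee_fin// csum_ge0// => z.
  by rewrite mule_ge0 ?lee_fin.
transitivity (\esum_(y in setT) \esum_(z in [set: S])
    ((B x z)%:E * (D z y * (u y)%:E))).
  apply: eq_esum => y _; rewrite /mxmul csum_ge0E; last first.
    by move=> z; rewrite mule_ge0 ?lee_fin.
  rewrite muleC /= -esumZl//; last by move=> z; rewrite mule_ge0 ?lee_fin.
  by apply: eq_esum => z _; rewrite muleC muleA.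
rewrite esum_exchange; last by move=> y z; rewrite !mule_ge0 ?lee_fin.
apply: eq_esum => z _; rewrite csum_ge0E; last by move=> y; rewrite mule_ge0 ?lee_fin.
by rewrite esumZl// => y; rewrite mule_ge0 ?lee_fin.
Qed.

(** * The kernel as a contraction in the [mu]-weighted norm *)

Variables (Q : S -> S -> R) (mu c : S -> R) (rho C : R).
Hypothesis Q_ge0 : forall x y, (0 <= Q x y)%R.
Hypothesis mu_gt0 : forall x, (0 < mu x)%R.
Hypothesis rho_ge0 : (0 <= rho)%R.
Hypothesis rho_lt1 : (rho < 1)%R.
Hypothesis C_ge0 : (0 <= C)%R.
Hypothesis Q_mu : forall x,
  \esum_(y in [set: S]) ((Q x y)%:E * (mu y)%:E) <= (rho * mu x)%:E.
(** Normalised by [1 - rho] so that the geometric series of bounds sums to [C mu]. *)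
Hypothesis c_le : forall x, (`|c x| <= (1 - rho) * C * mu x)%R.

Definition kact u (x : S) : R := pairing (Q x) u.

Lemma kactB u u' : mu_bounded mu u -> mu_bounded mu u' ->
  kact (fun y => u y - u' y)%R = (fun x => kact u x - kact u' x)%R.
Proof. by move=> bu bu'; apply/funext => x; exact: (pairingB (Q_ge0 x) (Q_mu x)). Qed.

Lemma mu_bounded0 : mu_bounded mu (fun=> 0%R).
Proof. by exists 0%R; split=> // y; rewrite normr0 mul0r. Qed.

(** Linearity comes from [kactB] alone: [0] is [0 - 0], [- u] is [0 - u], and [u + u'] is
    [u - (- u')]. *)
Lemma kact0 : kact (fun=> 0%R) = (fun=> 0%R).
Proof.
have := kactB mu_bounded0 mu_bounded0.
under eq_fun do rewrite subrr.
by move=> ->; apply/funext => x; rewrite subrr.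
Qed.

Lemma mu_boundedN u : mu_bounded mu u -> mu_bounded mu (fun y => - u y)%R.
Proof. by move=> [D [D0 uD]]; exists D; split=> // y; rewrite normrN. Qed.

Lemma kactN u : mu_bounded mu u ->
  kact (fun y => - u y)%R = (fun x => - kact u x)%R.
Proof.
move=> bu; have := kactB mu_bounded0 bu; rewrite kact0.
under eq_fun do rewrite sub0r.
by move=> ->; apply/funext => x; rewrite sub0r.
Qed.

Lemma mu_boundedD u u' : mu_bounded mu u -> mu_bounded mu u' ->
  mu_bounded mu (fun y => u y + u' y)%R.
Proof.
move=> bu /mu_boundedN bu'; have := mu_boundedB bu bu'.
by under [X in mu_bounded _ X]eq_fun do rewrite opprK.
Qed.

Lemma kactD u u' : mu_bounded mu u -> mu_bounded mu u' ->
  kact (fun y => u y + u' y)%R = (fun x => kact u x + kact u' x)%R.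
Proof.
move=> bu bu'; have := kactB bu (mu_boundedN bu'); rewrite kactN//.
under eq_fun do rewrite opprK.
by move=> ->; apply/funext => x; rewrite opprK.
Qed.

Lemma kact_le u D x : mu_bounded mu u -> (0 <= D)%R ->
  (forall y, u y <= D * mu y)%R -> (kact u x <= rho * D * mu x)%R.
Proof.
move=> bu D0 uD; rewrite (mulrC rho) -mulrA.
by apply: (pairing_le (Q_ge0 x) (Q_mu x)) => // y; apply: ltW.
Qed.

Lemma norm_kact_le u D x : (0 <= D)%R ->
  (forall y, `|u y| <= D * mu y)%R -> (`|kact u x| <= rho * D * mu x)%R.
Proof.
move=> D0 uD; have bu : mu_bounded mu u by exists D.
rewrite ler_norml; apply/andP; split; last first.
  by apply: kact_le => // y; rewrite (le_trans (ler_norm _)).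
have := @kact_le (fun y => - u y)%R D x (mu_boundedN bu) D0.
rewrite kactN// lerNl; apply => y.
by rewrite (le_trans _ (uD y))// -normrN ler_norm.
Qed.

Lemma mu_bounded_kact u : mu_bounded mu u -> mu_bounded mu (kact u).
Proof.
move=> [D [D0 uD]]; exists (rho * D)%R; split; first exact: mulr_ge0.
by move=> y; apply: norm_kact_le.
Qed.

Lemma norm_iter_kact_le u D n x : (0 <= D)%R ->
  (forall y, `|u y| <= D * mu y)%R ->
  (`|iter n kact u x| <= rho ^+ n * D * mu x)%R.
Proof.
move=> D0 uD; elim: n x => [|n IH] x; first by rewrite expr0 mul1r.
rewrite exprS -(mulrA rho); apply: norm_kact_le => //.
by rewrite mulr_ge0// exprn_ge0.
Qed.

Lemma mu_bounded_iter n u : mu_bounded mu u -> mu_bounded mu (iter n kact u).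
Proof. by move=> bu; elim: n => [//|n]; apply: mu_bounded_kact. Qed.

Lemma iter_kactB n u u' : mu_bounded mu u -> mu_bounded mu u' ->
  iter n kact (fun y => u y - u' y)%R =
  (fun x => iter n kact u x - iter n kact u' x)%R.
Proof.
move=> bu bu'; elim: n => [//|n IH].
by rewrite iterS IH kactB//; apply: mu_bounded_iter.
Qed.

Let eQ x y : \bar R := (Q x y)%:E.

(** Each power splits off its leftmost factor, which [mxact_mxmul] turns into one application of
    [kact]. *)
Lemma mxact_mxpow_ge0 n u x : mu_bounded mu u -> (forall y, (0 <= u y)%R) ->
  mxact (mxpow eQ n) (EFin \o u) x = (iter n kact u x)%:E.
Proof.
move=> bu u0; elim: n x => [|n IH] x; first exact: mxact_id.
rewrite [mxpow _ _]/= mxact_mxmul//; last by move=> *; apply: mxpow_ge0.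
rewrite [LHS](_ : _ = mxact eQ (EFin \o iter n kact u) x); last first.
  by congr mxact; apply/funext.
by apply: (pairingE (Q_ge0 x) (Q_mu x)); apply: mu_bounded_iter.
Qed.

Lemma summable_mxpow n u x : mu_bounded mu u -> (forall y, (0 <= u y)%R) ->
  summable setT (fun y => mxpow eQ n x y * (u y)%:E).
Proof.
move=> bu u0; have := mxact_mxpow_ge0 n x bu u0.
have p0 y : 0 <= mxpow eQ n x y * (u y)%:E.
  by rewrite mule_ge0 ?lee_fin// mxpow_ge0.
rewrite /mxact csum_ge0E// /summable => E.
by under eq_esum do rewrite gee0_abs//; rewrite E ltry.
Qed.

(** Powers live in [\bar R]; summability against the positive [mu] excludes infinite entries. *)
Lemma mxpow_fin n x y : mxpow eQ n x y \is a fin_num.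
Proof.
have bmu : mu_bounded mu mu.
  by exists 1%R; split=> // z; rewrite mul1r gtr0_norm.
have := summable_pinfty (summable_mxpow n x bmu (fun z => ltW (mu_gt0 z))) (I : setT y).
have : 0 <= mxpow eQ n x y by apply: mxpow_ge0.
by case: mxpow => // _; rewrite gt0_mulye// lte_fin.
Qed.

Lemma mxact_mxpow n u x : mu_bounded mu u ->
  mxact (mxpow eQ n) (EFin \o u) x = (iter n kact u x)%:E.
Proof.
(* [|u|] and [|u| - u] are nonnegative, so that sums may be interchanged. *)
move=> bu; pose a y := `|u y|%R; pose b y := (`|u y| - u y)%R.
have a0 y : (0 <= a y)%R by exact: normr_ge0.
have b0 y : (0 <= b y)%R by rewrite subr_ge0 ler_norm.
have ba : mu_bounded mu a.
  by case: bu => D [D0 uD]; exists D; split=> // y; rewrite normr_id.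
have bb : mu_bounded mu b by exact: mu_boundedB.
have -> : u = (fun y => a y - b y)%R
  by apply/funext => y; rewrite opprB addrCA subrr addr0.
rewrite iter_kactB// EFinB -!mxact_mxpow_ge0//.
rewrite /mxact -csumB; [|exact: summable_mxpow..].
by apply: eq_csum => y /=; rewrite EFinB muleBr ?mxpow_fin// fin_num_adde_defl.
Qed.

(** * Partial sums of the cost series and their limit *)

Definition psum n x : R := \sum_(0 <= k < n) iter k kact c x.

Lemma psum0 : psum 0 = fun=> 0%R.
Proof. by apply/funext => x; rewrite /psum big_nil. Qed.

Lemma psum_recr n : psum n.+1 = fun x => (psum n x + iter n kact c x)%R.
Proof. by apply/funext => x; rewrite /psum big_nat_recr. Qed.

Lemma c_bounded : mu_bounded mu c.
Proof.
by exists ((1 - rho) * C)%R; split=> //; rewrite mulr_ge0// subr_ge0 ltW.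
Qed.

(** The [k]-th term is at most [rho^k (1 - rho) C mu], and these bounds telescope. *)
Lemma psum_tail n m x : (n <= m)%N ->
  (`|psum m x - psum n x| <= (rho ^+ n - rho ^+ m) * C * mu x)%R.
Proof.
elim: m => [|m IH]; first by rewrite leqn0 => /eqP ->; rewrite !subrr normr0 !mul0r.
rewrite leq_eqVlt => /predU1P[->|]; first by rewrite !subrr normr0 !mul0r.
rewrite ltnS => /IH {}IH.
have -> : (psum m.+1 x - psum n x = (psum m x - psum n x) + iter m kact c x)%R.
  by rewrite psum_recr addrAC.
apply: (le_trans (ler_normD _ _)).
have -> : ((rho ^+ n - rho ^+ m.+1) * C * mu x = (rho ^+ n - rho ^+ m) * C * mu x +
    rho ^+ m * ((1 - rho) * C) * mu x)%R by rewrite exprS; ring.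
rewrite lerD//; apply: norm_iter_kact_le => //.
by rewrite mulr_ge0// subr_ge0 ltW.
Qed.

Lemma psum_cvg x : cvgn (psum ^~ x).
Proof.
apply: (@normed_cvg _ R^o (fun k => iter k kact c x)).
apply: (@series_le_cvg _ _ (geometric ((1 - rho) * C * mu x) rho)) => [n|n|n|].
- exact: normr_ge0.
- by rewrite /geometric/= !mulr_ge0 ?exprn_ge0 ?subr_ge0// ltW.
- rewrite /geometric/= mulrC mulrA; apply: norm_iter_kact_le => //.
  by rewrite mulr_ge0// subr_ge0 ltW.
- by apply: is_cvg_geometric_series; rewrite ger0_norm.
Qed.

Definition kval x : R := limn (psum ^~ x).

(** Limit of [psum_tail] as [m] grows, with [rho ^+ m] dropped. *)
Lemma kval_psum n x : (`|kval x - psum n x| <= rho ^+ n * C * mu x)%R.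
Proof.
have : (fun m => `|psum m x - psum n x|%R) @ \oo --> `|kval x - psum n x|%R.
  by apply: cvg_norm; apply: cvgB; [exact: psum_cvg|exact: cvg_cst].
move=> /[dup] /cvg_lim <-//; move=> /cvgP cv; apply: limr_le => //.
near=> m; apply: (le_trans (@psum_tail n m x _)); first by near: m; exists n.
rewrite ler_pM2r// ler_wpM2r// gerBl exprn_ge0//.
Unshelve. all: by end_near. Qed.

Lemma kval_le x : (`|kval x| <= C * mu x)%R.
Proof. by have := kval_psum 0 x; rewrite psum0 subr0 mul1r. Qed.

Lemma kval_bounded : mu_bounded mu kval.
Proof. by exists C; split=> //; exact: kval_le. Qed.

Lemma psum_bounded n : mu_bounded mu (psum n).
Proof.
elim: n => [|n IH].
  by rewrite psum0; exact: mu_bounded0.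
rewrite psum_recr; apply: mu_boundedD => //.
by apply: mu_bounded_iter; exact: c_bounded.
Qed.

(** Splits off the first term instead of the last: the value iteration behind [kval_fix]. *)
Lemma psumS n x : psum n.+1 x = (c x + kact (psum n) x)%R.
Proof.
elim: n x => [|n IH] x.
  by rewrite psum_recr psum0 kact0 add0r addr0.
rewrite psum_recr IH -addrA; congr +%R.
rewrite [psum n.+1]psum_recr kactD//; [exact: psum_bounded|].
by apply: mu_bounded_iter; exact: c_bounded.
Qed.

(** Replaces passages to the limit: claims are proved up to an error of order [rho ^+ n]. *)
Lemma geometric_bound_eq0 (a D : R) : (forall n, `|a| <= rho ^+ n * D)%R -> a = 0%R.
Proof.
move=> aD; apply/normr0_eq0/le_anti; rewrite normr_ge0 andbT.
have cv : (fun n => (rho ^+ n * D)%R) @ \oo --> (0 : R)%R.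
  rewrite -(mul0r D); apply: cvgM; last exact: cvg_cst.
  by apply: cvg_expr; rewrite ger0_norm.
rewrite -(cvg_lim _ cv)//; apply: limr_ge; first exact: cvgP cv.
by near=> n; exact: aD.
Unshelve. all: by end_near. Qed.

Lemma kval_fix x : kval x = (c x + kact kval x)%R.
Proof.
apply/eqP; rewrite -subr_eq0; apply/eqP.
(* Two errors of size [rho ^+ n.+1 * C * mu x]: the tail after [psum n.+1], and the kernel applied
   to the tail after [psum n]. *)
apply: (@geometric_bound_eq0 _ (2 * rho * C * mu x)%R) => n.
have -> : (kval x - (c x + kact kval x) = (kval x - psum n.+1 x) -
   kact (fun y => kval y - psum n y)%R x)%R.
  rewrite kactB; [|exact: kval_bounded|exact: psum_bounded].
  by rewrite psumS; ring.
apply: (le_trans (ler_normB _ _)).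
have := kval_psum n.+1 x.
have := @norm_kact_le (fun y => kval y - psum n y)%R (rho ^+ n * C)%R x
  (mulr_ge0 (exprn_ge0 n rho_ge0) C_ge0) (kval_psum n).
rewrite exprS => h1 h2; apply: (le_trans (lerD h2 h1)).
by rewrite le_eqVlt; apply/orP; left; apply/eqP; ring.
Qed.

(** The factor [r] serves both models: [1] for the total cost, [(mu x)^-1] for the transformed
    one. *)
Lemma eseries_kval (r : R) x :
  \sum_(0 <= n <oo) (r * iter n kact c x)%:E = (r * kval x)%:E.
Proof.
have -> : (fun n => \sum_(0 <= k < n) (r * iter k kact c x)%:E) =
    EFin \o (fun n => r * psum n x)%R.
  by apply/funext => n /=; rewrite sumEFin /psum mulr_sumr.
have cv : (fun n => r * psum n x)%R @ \oo --> (r * kval x)%R.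
  by apply: cvgM; [exact: cvg_cst|exact: psum_cvg].
by rewrite EFin_lim; [rewrite (cvg_lim _ cv)|exact: cvgP cv].
Qed.

(** The difference [d = u - u'] satisfies [d <= Q d], so iterating the monotone kernel on
    [d <= D mu] gives [d <= rho^n D mu] for every [n]. *)
Lemma kact_compare u u' : mu_bounded mu u -> mu_bounded mu u' ->
  (forall x, u x <= c x + kact u x)%R -> (forall x, c x + kact u' x <= u' x)%R ->
  forall x, (u x <= u' x)%R.
Proof.
move=> bu bu' Hu Hu' x.
have b := mu_boundedB bu bu'; case: (b) => D [D0 uD].
have step n y : (u y - u' y <= rho ^+ n * D * mu y)%R.
  elim: n y => [|n IH] y.
    by rewrite mul1r (le_trans (ler_norm _)).
  have := @kact_le _ (rho ^+ n * D)%R y b (mulr_ge0 (exprn_ge0 n rho_ge0) D0) IH.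
  rewrite kactB// => h; rewrite exprS -(mulrA rho); apply: le_trans h.
  by move: (Hu y) (Hu' y); lra.
rewrite leNgt; apply/negP => ux.
suff : (u x - u' x = 0)%R by move/eqP; rewrite subr_eq0 => /eqP e; rewrite e ltxx in ux.
apply: (@geometric_bound_eq0 _ (D * mu x)%R) => n.
by rewrite gtr0_norm ?subr_gt0// mulrA.
Qed.

End Kernel.

(** * Lower semicontinuity and minimisation over actions *)

Section LowerSemicontinuity.
Context {R : realType} {T : ptopologicalType}.
Variable K : set T.
Implicit Types (f g : T -> R).

(** Neighbourhoods are relative: for [a] in [K], [near a] in [subspace K] means near [a] within
    [K]. *)
Definition lsc_on f : Prop := forall (a : subspace K) t,
  K a -> (t < f a)%R -> \forall b \near a, (t < f b)%R.

Lemma lsc_onD f g : lsc_on f -> lsc_on g -> lsc_on (fun a => f a + g a)%R.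
Proof.
(* Each summand gets half of the slack above [t], so that [f a - e] and [g a - e] add up to [t]. *)
move=> lf lg a t Ka tfg; pose e := ((f a + g a - t) / 2)%R.
have fe : (f a - e < f a)%R by rewrite /e; lra.
have ge : (g a - e < g a)%R by rewrite /e; lra.
have := lf a _ Ka fe; have := lg a _ Ka ge.
apply: filterS2 => b gb fb.
have -> : t = ((f a - e) + (g a - e))%R by rewrite /e; field.
exact: ltrD.
Qed.

Lemma lsc_on_sum (I : eqType) (s : seq I) (F : I -> T -> R) :
  (forall i, lsc_on (F i)) -> lsc_on (fun a => \sum_(i <- s) F i a)%R.
Proof.
move=> lF; elim: s => [|i s IH].
  by move=> a t _; rewrite big_nil => t0; near=> b; rewrite big_nil.
move=> a t Ka; rewrite big_cons => /(lsc_onD (lF i) IH Ka).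
by apply: filterS => b; rewrite big_cons.
Unshelve. all: by end_near. Qed.

Lemma nbhs_subspace_self (a : subspace K) : K a -> nbhs a K.
Proof.
by move=> Ka; rewrite /nbhs/= -nbhs_subspace_in// /within/=; near=> b.
Unshelve. all: by end_near. Qed.

Lemma eq_lsc_on f g : (forall a, K a -> f a = g a) -> lsc_on f -> lsc_on g.
Proof.
move=> fg lf a t Ka; rewrite -fg// => /(lf _ _ Ka).
by apply: filterS2 (nbhs_subspace_self Ka) => b Kb; rewrite fg.
Qed.

Lemma continuous_lsc_on f : {within K, continuous f} -> lsc_on f.
Proof. by move=> cf a t _ tf; exact: (cvgr_gt _ (cf a) _ tf). Qed.

Lemma lower_semicontinuous_lsc_on f :
  lower_semicontinuous (fun a : subspace K => (f a)%:E) -> lsc_on f.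
Proof.
move=> lf a t Ka; rewrite -lte_fin => /lf[U aU Ut].
by apply: filterS aU => b /Ut; rewrite lte_fin.
Qed.

(** The function is continuous, so [k] may be negative, as in its use with [- D]. *)
Lemma lsc_on_scale_fine (k : R) (g : T -> \bar R) :
  (forall a, K a -> g a \is a fin_num) -> {within K, continuous g} ->
  lsc_on (fun a => k * fine (g a))%R.
Proof.
move=> gfin cg a t Ka; have ga : g b @[b --> a] --> (fine (g a))%:E.
  by rewrite fineK ?gfin//; exact: cg.
exact: (cvgr_gt _ (cvgM (cvg_cst k) (fine_cvg ga))).
Qed.

Lemma seq_min (s : seq T) f b : b \in s ->
  exists2 m, m \in s & forall x, x \in s -> (f m <= f x)%R.
Proof.
elim: s b => [//|c s IH] b _.
case: s IH => [_|d s /(_ d (mem_head _ _))[m ms mx]].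
  by exists c; rewrite ?mem_head// => x; rewrite inE => /eqP ->.
have [cm|mc] := leP (f c) (f m).
  exists c; rewrite ?mem_head// => x; rewrite inE => /predU1P[->//|/mx].
  exact: le_trans.
exists m; first by rewrite inE ms orbT.
by move=> x; rewrite inE => /predU1P[->|/mx//]; exact: ltW.
Qed.

(* If no point were a minimiser, the relatively open sets [f b < f] would cover
   [K]; the smallest [f b] of a finite subcover lies in none of its members. *)
Lemma lsc_on_min f : compact K -> K !=set0 -> lsc_on f ->
  exists2 a, K a & forall b, K b -> (f a <= f b)%R.
Proof.
rewrite compact_cover => cK [a0 Ka0] lf; apply: contrapT => nomin.
(* Adjoining the complement of [K] and taking the interior turns a relatively open set into one open
   in [T]. *)
pose U b := (~` K `|` [set x | f b < f x]%R)°.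
have /cK[] : forall b, K b -> open (U b) by move=> b _; exact: open_interior.
- move=> a Ka; apply: contrapT => aU; apply: nomin; exists a => // b Kb.
  rewrite leNgt; apply/negP => ba; apply: aU; exists b => //.
  have := lf a _ Ka ba; rewrite /prop_near1 /nbhs/= -nbhs_subspace_in// => h.
  have {}h : nbhs (a : T) [set x | K x -> (f b < f x)%R] := h.
  apply: filterS h => x h.
  by have [/h|] := pselect (K x); [right|left].
- move=> D DK Dcov; have [b0 b0D _] := Dcov _ Ka0.
  have [m mD mmin] := seq_min f b0D.
  have Km : K m by have := DK _ mD; rewrite inE.
  have [b bD] := Dcov _ Km; move=> /interior_subset[]// /=.
  by rewrite ltNge mmin.
Qed.

End LowerSemicontinuity.

(** * Lower semicontinuity in the action of sums against the rates *)

Section PairingLsc.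
Context {R : realType} {S : countType} {T : ptopologicalType}.
Variables (K : set T) (w : T -> S -> R) (W : S -> R).
Hypothesis w_ge0 : forall a y, K a -> (0 <= w a y)%R.
Hypothesis W_ge0 : forall y, (0 <= W y)%R.
Hypothesis w_cont : forall y, {within K, continuous (fun a => w a y)}.
Hypothesis wW_fin : forall a, K a ->
  \esum_(y in [set: S]) (w a y * W y)%:E < +oo.
Hypothesis wW_cont :
  {within K, continuous (fun a => \esum_(y in [set: S]) (w a y * W y)%:E)}.

Lemma wW_fin_num a : K a -> \esum_(y in [set: S]) (w a y * W y)%:E \is a fin_num.
Proof.
move=> Ka; rewrite ge0_fin_numE ?wW_fin//.
by apply: esum_ge0 => y _; rewrite lee_fin mulr_ge0// w_ge0.
Qed.

(** The pairing is a supremum of finite sums continuous in [a]; one that exceeds [t] at [a] still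
    does so nearby. *)
Lemma lsc_on_pairing_ge0 h : mu_bounded W h -> (forall y, (0 <= h y)%R) ->
  lsc_on K (fun a => pairing (w a) h).
Proof.
move=> bh h0.
have pE a : K a -> \esum_(y in [set: S]) (w a y * h y)%:E = (pairing (w a) h)%:E.
  move=> Ka.
  rewrite -(@pairingE _ _ W _ (fine (\esum_(y in [set: S]) (w a y * W y)%:E)))//.
  - by rewrite csum_ge0E// => y; rewrite -EFinM lee_fin mulr_ge0 ?w_ge0.
  - by move=> y; exact: w_ge0.
  - by rewrite fineK ?wW_fin_num.
move=> a t Ka; rewrite -lte_fin -pE// => /ereal_sup_gt[_ [F [finF _] <-]].
rewrite fsbig_finite//= sumEFin lte_fin => tF.
have lF : lsc_on K (fun b => \sum_(y <- finmap.enum_fset (fset_set F)) w b y * h y)%R.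
  apply: lsc_on_sum => y; apply: continuous_lsc_on => b.
  by apply: cvgM; [exact: w_cont|exact: cvg_cst].
near=> b; have Kb : K b by near: b; exact: nbhs_subspace_self.
have tb : (t < \sum_(y <- finmap.enum_fset (fset_set F)) w b y * h y)%R.
  by near: b; exact: lF.
rewrite -lte_fin -pE//; apply: (@lt_le_trans _ _ (\sum_(y \in F) (w b y * h y)%:E)).
  by rewrite fsbig_finite//= sumEFin lte_fin.
by apply: esum_ge; exists F.
Unshelve. all: by end_near. Qed.

(* With [h + D W >= 0], the pairing with [h] is a lower semicontinuous supremum of
   finite sums minus the continuous function [D * pairing (w a) W]. *)
Lemma lsc_on_pairing h : mu_bounded W h -> lsc_on K (fun a => pairing (w a) h).
Proof.
move=> bh; have [D [D0 hD]] := bh.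
have bW : mu_bounded W (fun y => D * W y)%R.
  by exists D; split=> // y; rewrite ger0_norm// mulr_ge0.
have bhN : mu_bounded W (fun y => - h y)%R.
  by exists D; split=> // y; rewrite normrN.
have bp := mu_boundedB bW bhN.
have p0 y : (0 <= D * W y - - h y)%R.
  by have := hD y; rewrite ler_norml => /andP[]; lra.
have lD := @lsc_on_scale_fine _ _ _ (- D)%R _ wW_fin_num wW_cont.
apply: eq_lsc_on (lsc_onD (lsc_on_pairing_ge0 bp p0) lD) => a Ka /=.
have wWr : \esum_(y in [set: S]) ((w a y)%:E * (W y)%:E) <=
    (fine (\esum_(y in [set: S]) (w a y * W y)%:E))%:E by rewrite fineK ?wW_fin_num.
have w0 y : (0 <= w a y)%R by exact: w_ge0.
have -> : (- D * fine (\esum_(y in [set: S]) (w a y * W y)%:E) =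
    - pairing (w a) (fun y => D * W y))%R.
  rewrite mulNr; congr (- _)%R; apply: EFin_inj.
  rewrite -(pairingE w0 wWr bW) EFinM fineK ?wW_fin_num//.
  under eq_csum do rewrite EFinM muleCA.
  rewrite csumZl// csum_ge0E// => y; by rewrite -EFinM lee_fin mulr_ge0.
rewrite -(pairingB w0 wWr bp bW).
congr pairing; apply/funext => y /=; ring.
Qed.

End PairingLsc.

(** * The transient model and its transformation *)

Section TransientMDP.
Context {R : realType} {X : countType} {A : completeMetricType R}.
Variable M : mdp X A.
Implicit Types (phi : X -> A) (u : X -> R).

Lemma avail_neq0 x : avail M x !=set0.
Proof. by case: M => ? av ? ? _ av0 * /=; exact: av0. Qed.

Lemma rate_ge0 x a y : avail M x a -> (0 <= rate M x a y)%R.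
Proof. by case: M => ? ? ? q ? ? ? ? ? q_ge0 ? ? /=; exact: (q_ge0 x a y). Qed.

Lemma policies_neq0 : exists phi, policies M phi.
Proof.
have /choice[phi phiA] : forall x, exists a, avail M x a by exact: avail_neq0.
by exists phi.
Qed.

Hypothesis compM : compactness_conditions M.
Variables (V mu : X -> R) (K rho C : R).
Hypothesis V_ge0 : forall x, (0 <= V x)%R.
Hypothesis drift_finite : forall x a, avail M x a ->
  \esum_(y in [set: X]) (rate M x a y * V y)%:E < +oo.
Hypothesis drift_cont : forall x, {within avail M x, continuous
  (fun a => \esum_(y in [set: X]) (rate M x a y * V y)%:E)}.
Hypothesis K_ge0 : (0 <= K)%R.
Hypothesis mu_gt0 : forall x, (0 < mu x)%R.
Hypothesis mu_le : forall x, (mu x <= K * V x)%R.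
Hypothesis rho_ge0 : (0 <= rho)%R.
Hypothesis rho_lt1 : (rho < 1)%R.
Hypothesis C_ge0 : (0 <= C)%R.
Hypothesis rate_mu : forall x a, avail M x a ->
  \esum_(y in [set: X]) ((rate M x a y)%:E * (mu y)%:E) <= (rho * mu x)%:E.
Hypothesis cost_le : forall x a, avail M x a ->
  (`|cost M x a| <= (1 - rho) * C * mu x)%R.

Definition action_value u (x : X) (a : A) : R :=
  (cost M x a + pairing (rate M x a) u)%R.

Definition policy_rate phi (x y : X) : R := rate M x (phi x) y.

Definition policy_cost phi (x : X) : R := cost M x (phi x).

Definition policy_value phi : X -> R :=
  kval (policy_rate phi) (policy_cost phi).

Lemma one_stepE u x a : mu_bounded mu u -> avail M x a ->
  one_step M (EFin \o u) x a = (action_value u x a)%:E.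
Proof.
move=> bu xa; rewrite /one_step EFinD -(pairingE _ (rate_mu xa))// => y.
exact: rate_ge0.
Qed.

Lemma action_value_mono u u' x a : mu_bounded mu u -> mu_bounded mu u' ->
  avail M x a -> (forall y, u y <= u' y)%R ->
  (action_value u x a <= action_value u' x a)%R.
Proof.
move=> bu bu' xa uu'; rewrite lerD2l -lee_fin.
have r0 y := rate_ge0 y xa.
rewrite -!(pairingE r0 (rate_mu xa))//.
by apply: le_csum => y; rewrite -!EFinM lee_fin ler_wpM2l.
Qed.

Lemma action_value_min u : mu_bounded mu u ->
  exists2 phi, policies M phi &
    forall x a, avail M x a -> (action_value u x (phi x) <= action_value u x a)%R.
Proof.
move=> [D [D0 uD]].
(* Continuity is assumed for sums weighted by [V], hence the passage from [mu] to [V] through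
   [mu <= K V]. *)
have bV : mu_bounded V u.
  exists (D * K)%R; split; first exact: mulr_ge0.
  by move=> y; rewrite (le_trans (uD y))// -mulrA ler_wpM2l.
have [Acompact lcost crate _] := compM.
have /choice[phi phiP] : forall x, exists a, avail M x a /\
    forall b, avail M x b -> (action_value u x a <= action_value u x b)%R.
  move=> x; have [] := @lsc_on_min _ _ (avail M x) (action_value u x).
  - exact: Acompact.
  - exact: avail_neq0.
  - apply: lsc_onD; first exact: lower_semicontinuous_lsc_on (lcost x).
    apply: lsc_on_pairing bV => //.
    + by move=> a y; exact: rate_ge0.
    + by move=> a; exact: drift_finite.
  - by move=> a xa amin; exists a.
by exists phi => [x|x a]; case: (phiP x) => // _; apply.
Qed.

(** * The value of a fixed policy *)

Section FixedPolicy.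
Variable phi : X -> A.
Hypothesis phiP : policies M phi.

Let Q_ge0 x y : (0 <= policy_rate phi x y)%R.
Proof. exact: rate_ge0 (phiP x). Qed.

Let Q_mu x :
  \esum_(y in [set: X]) ((policy_rate phi x y)%:E * (mu y)%:E) <= (rho * mu x)%:E.
Proof. exact: rate_mu (phiP x). Qed.

Let c_le x : (`|policy_cost phi x| <= (1 - rho) * C * mu x)%R.
Proof. exact: cost_le (phiP x). Qed.

Lemma policy_cost_bounded : mu_bounded mu (policy_cost phi).
Proof. exact: c_bounded rho_lt1 C_ge0 c_le. Qed.

Lemma mxact_Qmx n x :
  mxact (mxpow (Qmx M phi) n) (pol_cost (cost M) phi) x =
  (iter n (kact (policy_rate phi)) (policy_cost phi) x)%:E.
Proof. exact: (mxact_mxpow Q_ge0 mu_gt0 rho_ge0 Q_mu n x policy_cost_bounded). Qed.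

Lemma eseries_policy_value r x :
  \sum_(0 <= n <oo) (r%:E * mxact (mxpow (Qmx M phi) n) (pol_cost (cost M) phi) x) =
  (r * policy_value phi x)%:E.
Proof.
under eq_eseriesr do rewrite mxact_Qmx.
exact: (eseries_kval Q_ge0 mu_gt0 rho_ge0 rho_lt1 C_ge0 Q_mu c_le r x).
Qed.

Lemma total_costE x : total_cost M phi x = (policy_value phi x)%:E.
Proof.
rewrite -[policy_value phi x]mul1r -eseries_policy_value.
by apply: eq_eseriesr => n _; rewrite mul1e.
Qed.

Lemma norm_policy_value_le x : (`|policy_value phi x| <= C * mu x)%R.
Proof. exact: (kval_le Q_ge0 mu_gt0 rho_ge0 rho_lt1 C_ge0 Q_mu c_le x). Qed.

Lemma policy_value_bounded : mu_bounded mu (policy_value phi).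
Proof. by exists C; split=> //; exact: norm_policy_value_le. Qed.

Lemma policy_value_fix x :
  policy_value phi x = action_value (policy_value phi) x (phi x).
Proof. exact: (kval_fix Q_ge0 mu_gt0 rho_ge0 rho_lt1 C_ge0 Q_mu c_le x). Qed.

Lemma policy_value_le u : mu_bounded mu u ->
  (forall x, action_value u x (phi x) <= u x)%R ->
  forall x, (policy_value phi x <= u x)%R.
Proof.
move=> bu Hu.
apply: (@kact_compare _ _ _ _ (policy_cost phi) _
  Q_ge0 mu_gt0 rho_ge0 rho_lt1 Q_mu) => //.
  exact: policy_value_bounded.
by move=> x; rewrite {1}policy_value_fix.
Qed.

Lemma policy_value_ge u : mu_bounded mu u ->
  (forall x, u x <= action_value u x (phi x))%R ->
  forall x, (u x <= policy_value phi x)%R.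
Proof.
move=> bu Hu.
apply: (@kact_compare _ _ _ _ (policy_cost phi) _
  Q_ge0 mu_gt0 rho_ge0 rho_lt1 Q_mu) => //.
  exact: policy_value_bounded.
by move=> x; rewrite [leRHS]policy_value_fix.
Qed.

End FixedPolicy.

(** * The value function, the optimality equation and optimal policies *)

Definition value x : R := fine (total_value M x).

(** The infimum is finite: [- C mu] bounds all policy values from below, and some policy exists. *)
Lemma total_valueE x : total_value M x = (value x)%:E.
Proof.
have [phi phiP] := policies_neq0.
rewrite /value fineK// fin_numE; apply/andP; split.
  rewrite gt_eqF// (@lt_le_trans _ _ (- (C * mu x))%:E) ?ltNyr//.
  apply/ereal_infP => _ [psi psiP <-]; rewrite total_costE// lee_fin.
  by have := norm_policy_value_le psiP x; rewrite ler_norml => /andP[].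
rewrite lt_eqF// (@le_lt_trans _ _ (total_cost M phi x))//.
  by apply: ereal_inf_lbound; exists phi.
by rewrite total_costE// ltry.
Qed.

Lemma total_value_EFin : total_value M = EFin \o value.
Proof. by apply/funext => x; exact: total_valueE. Qed.

Lemma value_le phi x : policies M phi -> (value x <= policy_value phi x)%R.
Proof.
move=> phiP; rewrite -lee_fin -total_valueE -total_costE//.
by apply: ereal_inf_lbound; exists phi.
Qed.

Lemma le_value (r : R) x :
  (forall phi, policies M phi -> r <= policy_value phi x)%R -> (r <= value x)%R.
Proof.
move=> rphi; rewrite -lee_fin -total_valueE; apply/ereal_infP => _ [phi phiP <-].
by rewrite total_costE// lee_fin rphi.
Qed.

Lemma norm_value_le x : (`|value x| <= C * mu x)%R.
Proof.
have [phi phiP] := policies_neq0.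
rewrite ler_norml; apply/andP; split.
  apply: le_value => psi psiP.
  by have := norm_policy_value_le psiP x; rewrite ler_norml => /andP[].
apply: (le_trans (value_le x phiP)).
by have := norm_policy_value_le phiP x; rewrite ler_norml => /andP[].
Qed.

Lemma value_bounded : mu_bounded mu value.
Proof. by exists C; split=> //; exact: norm_value_le. Qed.

Lemma optimal_policy : exists2 phi, policies M phi &
  [/\ forall x, policy_value phi x = value x,
      forall x, action_value value x (phi x) = value x &
      forall x a, avail M x a -> (value x <= action_value value x a)%R].
Proof.
have [phi phiP phi_min] := action_value_min value_bounded.
have phiV x : policy_value phi x = value x.
  apply/le_anti; rewrite value_le// andbT; move: x.
  apply: policy_value_le => // [|x]; first exact: value_bounded.
  (* For every [psi], [T_phi v <= T_psi v <= T_psi v^psi = v^psi]; the infimum over [psi] gives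
     [T_phi v <= v]. *)
  apply: le_value => psi psiP; rewrite (policy_value_fix psiP).
  apply: (@le_trans _ _ (action_value value x (psi x))); first exact: phi_min.
  apply: action_value_mono => // [||y].
  - exact: value_bounded.
  - exact: policy_value_bounded.
  - exact: value_le.
have fixV x : action_value value x (phi x) = value x.
  have /funext E := phiV.
  by rewrite -{1}E -(policy_value_fix phiP) phiV.
exists phi => //; split=> // x a xa.
by rewrite -fixV phi_min.
Qed.

(** Every policy has [u <= T_phi u], so [u] lies below all policy values; a minimising selection
    [psi] has [T_psi u = u], so [v <= v^psi <= u]. *)
Lemma optimality_unique u : mu_bounded mu u ->
  optimality_equation M (EFin \o u) -> forall x, u x = value x.
Proof.
move=> bu uOE.
have /choice[psi psiP] : forall x, exists a, avail M x a /\ action_value u x a = u x.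
  move=> x; have [[a xa au] _] := uOE x; exists a; split=> //.
  by apply: EFin_inj; rewrite -one_stepE.
have psiA : policies M psi by move=> x; case: (psiP x).
have u_le x a : avail M x a -> (u x <= action_value u x a)%R.
  move=> xa; have [_ lb] := uOE x.
  by rewrite -lee_fin -one_stepE//; apply: lb; exists a.
move=> x; apply/le_anti/andP; split.
  apply: le_value => phi phiP; move: x; apply: policy_value_ge => // x.
  exact: u_le.
apply: (le_trans (value_le x psiA)); move: x; apply: policy_value_le => // x.
by case: (psiP x) => _ ->.
Qed.

Lemma value_optimality : optimality_equation M (total_value M).
Proof.
have [phi phiP [_ fixV minV]] := optimal_policy.
move=> x; rewrite total_value_EFin; split.
  by exists (phi x) => //; rewrite one_stepE ?fixV//; exact: value_bounded.
move=> _ [a xa <-]; rewrite one_stepE//; last exact: value_bounded.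
by rewrite lee_fin minV.
Qed.

Lemma conservingE x a : avail M x a ->
  conserving M x a <-> value x = action_value value x a.
Proof.
move=> xa; have bv := value_bounded.
rewrite /conserving/= total_value_EFin one_stepE//=.
by split=> [[_ E]|<-//]; exact: EFin_inj.
Qed.

(** Conserving actions mean [T_phi v = v]. An optimal [phi] has [v^phi = v], a fixed point;
    conversely [T_phi v <= v] forces [v^phi <= v]. *)
Lemma optimal_conserving phi : policies M phi ->
  (total_optimal M phi <-> forall x, conserving M x (phi x)).
Proof.
move=> phiP; split=> [[_ opt] x|cons].
  apply/conservingE => //.
  have E : policy_value phi = value.
    by apply/funext => y; apply: EFin_inj; rewrite -total_costE// -total_valueE.
  by rewrite -{1}E policy_value_fix// E.
have {}cons x : value x = action_value value x (phi x) by apply/conservingE.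
split=> // x; rewrite total_costE// total_valueE; congr EFin.
apply/le_anti; rewrite value_le// andbT; move: x.
by apply: policy_value_le => // [|x]; [exact: value_bounded|rewrite -cons].
Qed.

Lemma optimal_ex : exists phi, total_optimal M phi.
Proof.
have [phi phiP [E _ _]] := optimal_policy.
by exists phi; split=> // x; rewrite total_costE// total_valueE E.
Qed.

(** * The transformed discounted model *)

Section HV.
Variable beta : R.
Hypothesis beta_ge0 : (0 <= beta)%R.
(** At [beta = 0] discounting erases all transitions, so the conjugacy can hold only if the rates
    vanish. *)
Hypothesis rate_beta0 : beta = 0%R ->
  forall x a y, avail M x a -> rate M x a y = 0%R.

Notation p := (hv_prob M mu beta).

Lemma hv_prob_ge0 x a y : avail M x a -> 0 <= p (Some x) (Some a) (Some y).
Proof.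
move=> xa; rewrite lee_fin mulr_ge0//; last exact: ltW.
by rewrite mulr_ge0 ?rate_ge0// invr_ge0 mulr_ge0// ltW.
Qed.

Lemma beta_hv_prob x a y : avail M x a ->
  beta%:E * p (Some x) (Some a) (Some y) = ((mu x)^-1 * rate M x a y * mu y)%:E.
Proof.
move=> xa; rewrite -EFinM; congr EFin.
(* At [beta = 0] the quotient in [hv_prob] has the junk value 0. *)
have [b0|b0] := eqVneq beta 0%R; first by rewrite (rate_beta0 b0)// !(mulr0, mul0r).
by rewrite invfM; field; rewrite gt_eqF.
Qed.

Section Policy.
Variable phi : X -> A.
Hypothesis phiP : policies M phi.

Notation P := (pol_mx p (hv_policy phi)).

Lemma mxpow_hv_None n y : mxpow P n None (Some y) = 0.
Proof.
elim: n => [//|n IH].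
rewrite /mxpow iterS -/(mxpow _ _) /mxmul /csum !esum1 ?subee//.
  by move=> [z|] _; rewrite funenegE /pol_mx/= ?mul0e ?IH ?mule0 oppe0 maxxx.
by move=> [z|] _; rewrite funeposE /pol_mx/= ?mul0e ?IH ?mule0 maxxx.
Qed.

(** The path through the added state contributes nothing, by [mxpow_hv_None]: powers of the kernel
    restrict to the original states. *)
Lemma mxpow_hv_Some n x y :
  mxpow P n.+1 (Some x) (Some y) =
  \esum_(z in [set: X]) (P (Some x) (Some z) * mxpow P n (Some z) (Some y)).
Proof.
have P0 w z : 0 <= P (Some w) (Some z) by exact: hv_prob_ge0 (phiP w).
(* The recursion is first proved for nonnegative powers; that nonnegativity then follows by
   induction through [H] itself. *)
have H m w : (forall z, 0 <= mxpow P m (Some z) (Some y)) ->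
    mxpow P m.+1 (Some w) (Some y) =
    \esum_(z in [set: X]) (P (Some w) (Some z) * mxpow P m (Some z) (Some y)).
  move=> m0; have PN : P (Some w) None * mxpow P m None (Some y) = 0.
    by rewrite mxpow_hv_None mule0.
  rewrite [LHS](csum_option PN).
  by rewrite csum_ge0E// => z /=; rewrite mule_ge0.
have m0 m : forall z, 0 <= mxpow P m (Some z) (Some y).
  elim: m => [|m IH] z; first by rewrite lee_fin ler0n.
  by rewrite H// esum_ge0// => w _; rewrite mule_ge0.
exact: H.
Qed.

Lemma mxpow_hv_ge0 n x y : 0 <= mxpow P n (Some x) (Some y).
Proof.
elim: n x => [|n IH] x; first by rewrite lee_fin ler0n.
rewrite mxpow_hv_Some esum_ge0// => z _; rewrite mule_ge0//.
exact: hv_prob_ge0 (phiP x).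
Qed.

(** The conjugation by [mu] telescopes: the factor [mu z] of one step cancels the [(mu z)^-1] of the
    next. *)
Lemma mxpow_hv n x y :
  (beta ^+ n)%:E * mxpow P n (Some x) (Some y) =
  ((mu x)^-1)%:E * (mxpow (Qmx M phi) n x y * (mu y)%:E).
Proof.
have Q0 w z : 0 <= Qmx M phi w z by rewrite lee_fin; exact: rate_ge0 (phiP w).
elim: n x => [|n IH] x.
  rewrite expr0 mul1e /= /mxid -!EFinM; congr EFin.
  rewrite (inj_eq (@Some_inj _)).
  have [->|_] := eqVneq x y; last by rewrite mul0r mulr0.
  by rewrite mul1r mulVf// gt_eqF.
rewrite mxpow_hv_Some -esumZl ?exprn_ge0//; last first.
  by move=> z; rewrite mule_ge0 ?mxpow_hv_ge0//; exact: hv_prob_ge0 (phiP x).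
rewrite [mxpow _ n.+1 x y]/= /mxmul csum_ge0E; last first.
  by move=> z; rewrite mule_ge0// mxpow_ge0.
rewrite (muleC (esum _ _)) muleA -EFinM -esumZl; last 2 first.
- by rewrite mulr_ge0// ?invr_ge0 ltW.
- by move=> z; rewrite mule_ge0// mxpow_ge0.
apply: eq_esum => z _.
rewrite exprS EFinM -muleA (muleCA _ (P _ _)) IH muleA (beta_hv_prob z (phiP x)).
rewrite -[Qmx M phi x z]/((policy_rate phi x z)%:E).
rewrite !EFinM !muleA.
have E : (mu z)%:E * ((mu z)^-1)%:E = 1 by rewrite -EFinM divff// gt_eqF.
rewrite -(muleA _ (mu z)%:E) E mule1.
by rewrite -!muleA; congr (_ * _); rewrite [RHS]muleC -muleA.
Qed.

(** The remaining factor [mu y] cancels the division in [hv_cost], and the added state is free of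
    cost. *)
Lemma mxact_hv n x :
  (beta ^+ n)%:E *
    mxact (mxpow P n) (pol_cost (hv_cost M mu) (hv_policy phi)) (Some x) =
  ((mu x)^-1)%:E * mxact (mxpow (Qmx M phi) n) (pol_cost (cost M) phi) x.
Proof.
rewrite /mxact csum_option; last by rewrite mule0.
rewrite -!csumZl ?exprn_ge0// ?invr_ge0 ?ltW//.
apply: eq_csum => y /=; rewrite muleA mxpow_hv -!muleA; congr (_ * (_ * _)).
by rewrite /pol_cost/= -EFinM mulrA divff ?mul1r// gt_eqF.
Qed.

Lemma hv_discounted_cost_Some x :
  hv_discounted_cost M mu beta phi (Some x) = ((mu x)^-1 * policy_value phi x)%:E.
Proof.
rewrite -eseries_policy_value//; apply: eq_eseriesr => n _.
exact: mxact_hv.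
Qed.

Lemma hv_discounted_cost_None : hv_discounted_cost M mu beta phi None = 0.
Proof.
apply: eseries0 => n _ _; rewrite /mxact (_ : (fun y => _) = cst 0).
  by rewrite csum_ge0E// esum1// mule0.
by apply/funext => -[y|]; rewrite ?mxpow_hv_None ?mul0e// /pol_cost/= mule0.
Qed.

End Policy.

Lemma hv_value_Some x : hv_value M mu beta (Some x) = ((mu x)^-1 * value x)%:E.
Proof.
rewrite EFinM -total_valueE -ereal_inf_pZl ?invr_gt0//.
congr ereal_inf; apply/seteqP; split=> [_ [phi phiP <-]|_ [_ [phi phiP <-] <-]].
  exists (total_cost M phi x); first by exists phi.
  by rewrite total_costE// hv_discounted_cost_Some.
by exists phi => //; rewrite total_costE// hv_discounted_cost_Some.
Qed.

Lemma hv_value_None : hv_value M mu beta None = 0.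
Proof.
rewrite /hv_value (_ : [set _ | _ in _] = [set 0]) ?ereal_inf1//.
apply/seteqP; split=> [_ [phi phiP <-]|_ ->]; first exact: hv_discounted_cost_None.
have [phi phiP] := policies_neq0.
by exists phi => //; exact: hv_discounted_cost_None.
Qed.

Lemma total_value_hv x : total_value M x = (mu x)%:E * hv_value M mu beta (Some x).
Proof.
by rewrite hv_value_Some -EFinM mulrA divff ?mul1r ?gt_eqF// total_valueE.
Qed.

(** Division by [mu x] turns one equation into the other; the added state drops out because its
    value is 0. *)
Lemma conserving_hv x : conserving M x = hv_conserving M mu beta x.
Proof.
have S a : avail M x a ->
    beta%:E * csum (fun y => p (Some x) (Some a) y * hv_value M mu beta y) =
    ((mu x)^-1 * pairing (rate M x a) value)%:E.
  move=> xa; have r0 y := rate_ge0 y xa.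
  rewrite csum_option ?hv_value_None ?mule0//.
  rewrite EFinM -(pairingE r0 (rate_mu xa) value_bounded).
  rewrite -!csumZl ?invr_ge0 ?(ltW (mu_gt0 _))//; apply: eq_csum => y /=.
  rewrite muleA beta_hv_prob// hv_value_Some -!EFinM; congr EFin.
  by field; rewrite !gt_eqF.
have E a : avail M x a -> conserving M x a <-> hv_conserving M mu beta x a.
  move=> xa; rewrite conservingE// /hv_conserving/= S// hv_value_Some -EFinD -mulrDr.
  split=> [E|[_ E]]; first by rewrite [in LHS]E.
  by apply: mulfI (EFin_inj E); rewrite invr_eq0 gt_eqF.
by apply/seteqP; split=> a /[dup] -[xa _] /E; apply.
Qed.

End HV.
End TransientMDP.

(** * Contraction constants from the original hypotheses, and assembly of the claims *)

Theorem theorem6 (R : realType) (X : countType) (A : completeMetricType R)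
    (sepA : separable A) (M : mdp X A) (compM : compactness_conditions M)
    (V : X -> R) (K cbar : R)
    (V_weight : weight V) (K_ge1 : (1 <= K)%R)
    (transient : forall phi, policies M phi ->
      wmxnorm V (mxpow_series (Qmx M phi)) <= K%:E)
    (cost_bounded : forall x,
      ereal_sup [set `|cost M x a|%:E | a in avail M x] <= (cbar * V x)%:E)
    (drift_continuous : forall x,
      (forall a, avail M x a ->
        \esum_(y in [set: X]) (rate M x a y * V y)%:E < +oo) /\
      {within avail M x, continuous
        (fun a => \esum_(y in [set: X]) (rate M x a y * V y)%:E)})
    (mu : X -> R)
    (mu_bounds : forall x, (V x <= mu x)%R /\ (mu x <= K * V x)%R)
    (mu_drift : forall x a, avail M x a ->
      (V x)%:E + \esum_(y in [set: X]) (rate M x a y * mu y)%:E <= (mu x)%:E)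
    (beta : R) (beta_ge : ((K - 1) / K <= beta)%R) (beta_lt1 : (beta < 1)%R) :
  [/\ (forall x, total_value M x = (mu x)%:E * hv_value M mu beta (Some x)) /\
      unique (fun u : X -> \bar R =>
          optimality_equation M u /\ wnorm V u < +oo)
        (total_value M),
      exists phi, total_optimal M phi &
      (forall phi, policies M phi ->
        (total_optimal M phi <-> forall x, conserving M x (phi x))) /\
      (forall x, conserving M x = hv_conserving M mu beta x)].
Proof.
have K_gt0 : (0 < K)%R by exact: lt_le_trans ltr01 K_ge1.
have V_ge0 x : (0 <= V x)%R by exact: le_trans ler01 (V_weight x).
have V_gt0 x : (0 < V x)%R by exact: lt_le_trans ltr01 (V_weight x).
have mu_gt0 x : (0 < mu x)%R by have [+ _] := mu_bounds x; exact: lt_le_trans.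
have mu_le x : (mu x <= K * V x)%R by case: (mu_bounds x).
(* By the drift and [mu <= K V], [Q mu <= mu - V <= (1 - 1/K) mu], which fixes [rho]; [C] makes
   [(1 - rho) C] equal to [|cbar|]. *)
pose rho := ((K - 1) / K)%R; pose C := (K * `|cbar|)%R.
have rho_ge0 : (0 <= rho)%R by rewrite divr_ge0 ?subr_ge0// ltW.
have rho1 : (1 - rho = K^-1)%R by rewrite /rho; field; rewrite gt_eqF.
have rho_lt1 : (rho < 1)%R by rewrite -subr_gt0 rho1 invr_gt0.
have C_ge0 : (0 <= C)%R by rewrite mulr_ge0// ltW.
have rate_mu x a : avail M x a ->
    \esum_(y in [set: X]) ((rate M x a y)%:E * (mu y)%:E) <= (rho * mu x)%:E.
  move=> xa; under eq_esum do rewrite -EFinM.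
  rewrite -(leeD2lE (x := (V x)%:E))// (le_trans (mu_drift x a xa))//.
  rewrite -EFinD lee_fin -lerBlDr -{1}[mu x]mul1r -mulrBl rho1.
  by rewrite mulrC ler_pdivrMr// mulrC.
have cost_le x a : avail M x a -> (`|cost M x a| <= (1 - rho) * C * mu x)%R.
  move=> xa; rewrite rho1 /C mulrA mulVf ?gt_eqF// mul1r -lee_fin.
  apply: (@le_trans _ _ (cbar * V x)%:E).
    by apply: le_trans (cost_bounded x); apply: ereal_sup_ubound; exists a.
  rewrite lee_fin (@le_trans _ _ (`|cbar| * V x)%R)//.
    by rewrite ler_wpM2r// ler_norm.
  by rewrite ler_wpM2l//; case: (mu_bounds x).
have drift_finite x a : avail M x a ->
    \esum_(y in [set: X]) (rate M x a y * V y)%:E < +oo.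
  by case: (drift_continuous x) => + _; apply.
have drift_cont x : {within avail M x, continuous
    (fun a => \esum_(y in [set: X]) (rate M x a y * V y)%:E)}.
  by case: (drift_continuous x).
have beta_ge0 : (0 <= beta)%R by exact: le_trans beta_ge.
have rate_beta0 : beta = 0%R -> forall x a y, avail M x a -> rate M x a y = 0%R.
  (* Here [0 <= rho <= beta = 0], so the sum of the rates against the positive [mu] is at most 0 and
     each term vanishes. *)
  move=> b0 x a y xa.
  have rho0 : rho = 0%R by apply/le_anti; rewrite rho_ge0 andbT -b0.
  have r0 z : 0 <= (rate M x a z)%:E * (mu z)%:E.
    by rewrite mule_ge0 ?lee_fin ?rate_ge0// ltW.
  have := rate_mu x a xa; rewrite rho0 mul0r => le0.
  have : (rate M x a y)%:E * (mu y)%:E <= 0.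
    apply: le_trans le0.
    rewrite -(@esum_set1 _ _ y (fun z => (rate M x a z)%:E * (mu z)%:E))//.
    by rewrite [leLHS]esum_mkcond; apply: le_esum => z _; case: ifP.
  rewrite -EFinM lee_fin pmulr_lle0// => r_le0.
  by apply/le_anti; rewrite r_le0 rate_ge0.
have K_ge0 := ltW K_gt0.
have valueE := total_valueE mu_gt0 rho_ge0 rho_lt1 C_ge0 rate_mu cost_le.
split.
- split.
    exact: (total_value_hv mu_gt0 rho_ge0 rho_lt1 C_ge0 rate_mu cost_le
      beta_ge0 rate_beta0).
  split.
    split.
      exact: (value_optimality compM V_ge0 drift_finite drift_cont K_ge0 mu_gt0 mu_le
        rho_ge0 rho_lt1 C_ge0 rate_mu cost_le).
    (* From [|v| <= C mu <= C K V]. *)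
    apply: (@le_lt_trans _ _ (C * K)%:E); last exact: ltry.
    apply: ge_ereal_sup => _ [x _ <-].
    rewrite valueE//= -EFinM lee_fin.
    rewrite mulrC ler_pdivrMr// -mulrA.
    apply: (le_trans (norm_value_le mu_gt0 rho_ge0 rho_lt1 C_ge0 rate_mu cost_le x)).
    by rewrite ler_wpM2l.
  move=> u [uOE uV].
  (* A finite [V]-norm and [V <= mu] give finite values and a bound by [mu], so that
     [optimality_unique] applies to [fine \o u]. *)
  have [D D0 uD] : exists2 D : R, (0 <= D)%R & forall x, `|u x| <= (D * mu x)%:E.
    have ub x : ((V x)^-1)%:E * `|u x| <= wnorm V u.
      by apply: ereal_sup_ubound; exists x.
    exists `|fine (wnorm V u)|%R => // x.
    have w0 : 0 <= wnorm V u.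
      by apply: le_trans (ub x); rewrite mule_ge0// lee_fin invr_ge0.
    have wE : wnorm V u = (fine (wnorm V u))%:E by rewrite fineK// ge0_fin_numE.
    have := ub x; rewrite wE.
    rewrite -(@lee_pmul2l _ (V x)%:E)// ?lte_fin// muleA -EFinM divff ?gt_eqF// mul1e.
    move=> /le_trans; apply; rewrite -EFinM lee_fin mulrC.
    by rewrite ler_pM// ?ler_norm ?fine_ge0//; case: (mu_bounds x).
  have ufin x : u x \is a fin_num.
    by rewrite -abse_fin_num ge0_fin_numE// (le_lt_trans (uD x))// ltry.
  have uE : u = EFin \o (fine \o u) by apply/funext => x /=; rewrite fineK.
  have bu : mu_bounded mu (fine \o u).
    exists D; split=> // x; have := uD x.
    by rewrite -[in X in X -> _](fineK (ufin x)) /= lee_fin.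
  apply/funext => x; rewrite uE valueE//=; congr EFin.
  symmetry; apply: (optimality_unique mu_gt0 rho_ge0 rho_lt1 C_ge0 rate_mu cost_le bu).
  by rewrite -uE.
- exact: (optimal_ex compM V_ge0 drift_finite drift_cont K_ge0 mu_gt0 mu_le
    rho_ge0 rho_lt1 C_ge0 rate_mu cost_le).
- split=> [phi phiP|x].
    exact: (optimal_conserving mu_gt0 rho_ge0 rho_lt1 C_ge0 rate_mu cost_le).
  exact: (conserving_hv mu_gt0 rho_ge0 rho_lt1 C_ge0 rate_mu cost_le
      beta_ge0 rate_beta0).
Qed.
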